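(* Let $T\ge 1$, $L>0$, and let $f_1,\dots,f_T:\mathbb{R}^d\to\mathbb{R}$ be convex and $L$-smooth. Let $f=\frac1T\sum_{t=1}^T f_t$, assume $f$ has a minimizer $x_*\in\arg\min f$, and let $\sigma_*^2:=\frac1T\sum_{t=1}^T\|\nabla f_t(x_* )\|^2<\infty$. Let $\alpha,\beta>0$ satisfy $\frac1\alpha+\frac1\beta\le\frac12$. If the step size is fixed with $0<\eta\le\frac{1}{\sqrt\beta\,TL}$, then the output $x_K$ of Incremental Gradient Descent with uniformly random shuffling (either random reshuffling or shuffle-once), started at $x_0$, satisfies $$\mathbb{E}[f(x_K)-f(x_* )]\le \mathrm{e}\,\eta^2\sigma_*^2TL\,(1+\beta/\alpha)\,K^{\frac{\alpha/\beta}{1+\alpha/\beta}}+\frac{\mathrm{e}\,\|x_0-x_*\|^2}{2T\eta K^{\frac{1}{1+\alpha/\beta}}}.$$ Moreover, with $\alpha=4$, $\beta=4\log K$, for every $\epsilon>0$ there is a constant step size $\eta$ such that $\mathbb{E}[f(x_K)-f(x_* )]\le\epsilon$ after $$TK=\widetilde{\mathcal{O}}\Big(\frac{TL\|x_0-x_*\|^2}{\epsilon}+\frac{\sqrt{TL}\,\sigma_*\|x_0-x_*\|^2}{\epsilon^{3/2}}\Big)$$ individual gradient evaluations.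
   Context: $\|\cdot\|$ is the Euclidean norm on $\mathbb{R}^d$. A differentiable $g$ is $L$-smooth if $\|\nabla g(x)-\nabla g(y)\|\le L\|x-y\|$ for all $x,y$. Shuffled Incremental Gradient Descent: given a deterministic $x_0\in\mathbb{R}^d$, number of epochs $K$, and step size $\eta>0$; for $k=1,\dots,K$ let $\pi^{(k)}$ be the permutation of $\{1,\dots,T\}$ used in epoch $k$, set $x_{k-1,1}=x_{k-1}$, then for $t=1,\dots,T$ set $x_{k-1,t+1}=x_{k-1,t}-\eta\nabla f_{\pi^{(k)}(t)}(x_{k-1,t})$, and set $x_k=x_{k-1,T+1}$. The output is $x_K$; each epoch uses $T$ individual gradient evaluations. Random reshuffling (RR): the $\pi^{(k)}$ are independent uniformly random permutations, one generated at the start of each epoch. Shuffle-once (SO): one uniformly random permutation $\pi$ is generated at the beginning and $\pi^{(k)}=\pi$ for all $k$. The expectation is over all this randomness. Convention for the complexity claim: $\widetilde{\mathcal O}(X)$ means at most $C\,X\,(\log(\mathrm{e}+X))^p$ for absolute constants $C,p>0$, and the claim is that there exist an integer $K$ (with $\log K\ge1$) and a step size $\eta$ (allowed to depend on $K$ and the problem parameters) for which the expected gap is at most $\epsilon$ and $TK=\widetilde{\mathcal O}(X)$; as usual the bound is read in the regime $X\ge T$ (at least one epoch). *)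

(* Defs.v *)
From HB Require Import structures.
From mathcomp Require Import all_boot all_order all_fingroup all_algebra.
From mathcomp Require Import all_classical all_reals all_analysis.

Set Implicit Arguments.
Unset Strict Implicit.
Unset Printing Implicit Defensive.

Import Order.TTheory GRing.Theory Num.Theory.
Import numFieldNormedType.Exports.

Local Open Scope ring_scope.

(* The canonical norm [`|x|] on ['rV[R]_d] is the sup norm, hence a separate
   Euclidean norm. Both induce the same notion of differentiability. *)
Definition enorm (R : realType) (d : nat) (x : 'rV[R]_d) : R :=
  Num.sqrt (\sum_(i < d) x ord0 i ^+ 2).

Definition grad (R : realType) (d : nat) (g : 'rV[R]_d -> R) (x : 'rV[R]_d) :
    'rV[R]_d :=
  \row_(i < d) 'D_(delta_mx ord0 i) g x.

Definition smooth (R : realType) (d : nat) (L : R) (g : 'rV[R]_d -> R) : Prop :=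
  (forall x, differentiable g x) /\
  (forall x y, enorm (grad g x - grad g y) <= L * enorm (x - y)).

Definition avg (R : realType) (d T : nat) (f : 'I_T -> 'rV[R]_d -> R)
    (x : 'rV[R]_d) : R :=
  T%:R^-1 * \sum_(t < T) f t x.

Definition is_minimizer (R : realType) (d : nat) (g : 'rV[R]_d -> R)
    (xs : 'rV[R]_d) : Prop :=
  forall x, g xs <= g x.

Definition sigma2 (R : realType) (d T : nat) (f : 'I_T -> 'rV[R]_d -> R)
    (xs : 'rV[R]_d) : R :=
  T%:R^-1 * \sum_(t < T) enorm (grad (f t) xs) ^+ 2.

(* [enum 'I_n] lists 0, ..., n-1 in increasing order, so both folds below run
   through the steps (resp. the epochs) in order. Components, steps and epochs
   are numbered from 0. *)
Definition igd_epoch (R : realType) (d T : nat) (f : 'I_T -> 'rV[R]_d -> R)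
    (eta : R) (p : 'S_T) (x : 'rV[R]_d) : 'rV[R]_d :=
  foldl (fun y t => y - eta *: grad (f (p t)) y) x (enum 'I_T).

Definition igd (R : realType) (d T : nat) (f : 'I_T -> 'rV[R]_d -> R)
    (eta : R) (x0 : 'rV[R]_d) (K : nat) (pi : 'I_K -> 'S_T) : 'rV[R]_d :=
  foldl (fun x k => igd_epoch f eta (pi k) x) x0 (enum 'I_K).

Inductive shuffling := RandomReshuffling | ShuffleOnce.

(* Expectation of a function of the permutations of the K epochs. For random
   reshuffling their joint law is the product of K uniform laws on ['S_T]; for
   shuffle-once a single uniform permutation is used in every epoch. *)
Definition shuffle_expectation (R : realType) (s : shuffling) (T K : nat)
    (g : ('I_K -> 'S_T) -> R) : R :=
  match s with
  | RandomReshuffling =>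
      \sum_(pi : {ffun 'I_K -> 'S_T})
         (\prod_(k < K) #|{perm 'I_T}|%:R^-1) * g pi
  | ShuffleOnce =>
      \sum_(p : 'S_T) #|{perm 'I_T}|%:R^-1 * g (fun=> p)
  end.

Definition expected_gap (R : realType) (s : shuffling) (d T : nat)
    (f : 'I_T -> 'rV[R]_d -> R) (xs x0 : 'rV[R]_d) (eta : R) (K : nat) : R :=
  shuffle_expectation s
    (fun pi : 'I_K -> 'S_T => avg f (igd f eta x0 pi) - avg f xs).

Definition complexity (R : realType) (d T : nat) (L : R)
    (f : 'I_T -> 'rV[R]_d -> R) (xs x0 : 'rV[R]_d) (eps : R) : R :=
  T%:R * L * enorm (x0 - xs) ^+ 2 / eps
  + Num.sqrt (T%:R * L) * Num.sqrt (sigma2 f xs) * enorm (x0 - xs) ^+ 2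
    / eps `^ (3 / 2).

(* Main.v *)
(** In every epoch, smoothness at the end point and cocoercivity at each inner
    iterate give, for every comparison point z and every permutation,
    gap(x+) + c |x+ - z|^2 <= (1 + alpha/beta) gap(z) + c |x - z|^2 + W with
    c = 1 / (2 eta T), where the noise W depends only on the permutation and on
    the gradients at the minimizer; this is why reshuffling and shuffle-once
    are treated alike, and sampling without replacement bounds the mean of W.
    The last iterate is reached by letting z drift from the minimizer towards
    the iterates with weights making all earlier gaps telescope; the weights are
    products of the factors 1 + b/m with b = 1 / (1 + alpha/beta), which
    Bernoulli's inequality compares with powers of m. The resulting bound holds
    even without the factor e. *)

Require Import Defs.
From HB Require Import structures.
From mathcomp Require Import all_boot all_order all_fingroup all_algebra.
From mathcomp Require Import all_classical all_reals all_analysis.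
From mathcomp Require Import ring lra.

Import Order.TTheory GRing.Theory Num.Theory.
Import numFieldNormedType.Exports.

Local Open Scope ring_scope.

(** * Euclidean inner product and inequalities of Young type *)

Definition dot {R : realType} {d : nat} (u v : 'rV[R]_d) : R :=
  \sum_(i < d) u ord0 i * v ord0 i.

Section Dot.
Context {R : realType} {d : nat}.
Implicit Types (u v w x y z : 'rV[R]_d) (a b c : R).

Lemma dotC u v : dot u v = dot v u.
Proof. by apply: eq_bigr => i _; rewrite mulrC. Qed.

Lemma dotDl u v w : dot (u + v) w = dot u w + dot v w.
Proof. by rewrite -big_split; apply: eq_bigr => i _; rewrite mxE mulrDl. Qed.

Lemma dotZl a u v : dot (a *: u) v = a * dot u v.
Proof. by rewrite mulr_sumr; apply: eq_bigr => i _; rewrite mxE mulrA. Qed.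

Lemma dotNl u v : dot (- u) v = - dot u v.
Proof. by rewrite -scaleN1r dotZl mulN1r. Qed.

Lemma dot0l v : dot 0 v = 0.
Proof. by rewrite -(scale0r 0) dotZl mul0r. Qed.

Lemma dotDr u v w : dot u (v + w) = dot u v + dot u w.
Proof. by rewrite dotC dotDl !(dotC u). Qed.

Lemma dotZr a u v : dot u (a *: v) = a * dot u v.
Proof. by rewrite dotC dotZl dotC. Qed.

Lemma dotNr u v : dot u (- v) = - dot u v.
Proof. by rewrite dotC dotNl dotC. Qed.

Lemma dot_suml (I : Type) (r : seq I) (P : pred I) (F : I -> 'rV[R]_d) v :
  dot (\sum_(i <- r | P i) F i) v = \sum_(i <- r | P i) dot (F i) v.
Proof.
by apply: (big_morph (dot ^~ v)) => [u w|]; [exact: dotDl|exact: dot0l].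
Qed.

Lemma dot_sumr (I : Type) (r : seq I) (P : pred I) (F : I -> 'rV[R]_d) v :
  dot v (\sum_(i <- r | P i) F i) = \sum_(i <- r | P i) dot v (F i).
Proof. by rewrite dotC dot_suml; apply: eq_bigr => i _; rewrite dotC. Qed.

Definition dotE :=
  (@dotDl, @dotDr, @dotZl, @dotZr, @dotNl, @dotNr).

Lemma dot_ge0 u : 0 <= dot u u.
Proof. by apply: sumr_ge0 => i _; rewrite -expr2 sqr_ge0. Qed.

Lemma dot_le0 u : dot u u <= 0 -> u = 0.
Proof.
move=> u0; have /eqP := le_anti (introT andP (conj u0 (dot_ge0 u))).
rewrite psumr_eq0 => [/allP h|i _]; last by rewrite -expr2 sqr_ge0.
apply/rowP => i; rewrite mxE; apply/eqP.
by have := h i (mem_index_enum i); rewrite mulf_eq0 orbb.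
Qed.

Lemma enorm_sqr u : enorm u ^+ 2 = dot u u.
Proof.
have := dot_ge0 u; rewrite /enorm /dot => h.
rewrite sqr_sqrtr; last by under eq_bigr do rewrite expr2.
by under eq_bigr do rewrite expr2.
Qed.

Lemma enorm_ge0 u : 0 <= enorm u.
Proof. exact: sqrtr_ge0. Qed.

Lemma dot2_le u v : 2 * dot u v <= dot u u + dot v v.
Proof. by have := dot_ge0 (u - v); rewrite !dotE (dotC v u); lra. Qed.

(** Cauchy-Schwarz for an unweighted sum: in the induction the new vector is paired with each of the
    others through [dot2_le]. *)
Lemma dot_sum_le (s : seq 'rV[R]_d) :
  dot (\sum_(u <- s) u) (\sum_(u <- s) u)
    <= (size s)%:R * \sum_(u <- s) dot u u.
Proof.
elim: s => [|u s IH] /=; first by rewrite !big_nil dot0l mul0r.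
have h : 2 * dot u (\sum_(v <- s) v)
    <= (size s)%:R * dot u u + \sum_(v <- s) dot v v.
  elim: (s) => [|v t IHt] /=; first by rewrite !big_nil dotC dot0l !mul0r mulr0 addr0.
  by rewrite !big_cons dotDr -natr1; have := dot2_le u v; lra.
by rewrite !big_cons !dotE (dotC _ u) -natr1; lra.
Qed.

(** Splitting off [w] costs a factor 2; what remains is Young's inequality for [u + v] with weights
    [b / 2] and [a / 2], which holds exactly because their inverses sum to at most 1. This is where
    the condition on alpha and beta enters. *)
Lemma dot_add3_le a b u v w :
  0 < a -> 0 < b -> a^-1 + b^-1 <= 1 / 2 ->
  dot (u + v + w) (u + v + w) <= b * dot u u + a * dot v v + 2 * dot w w.
Proof.
move=> a0 b0 hab.
have hab' : 2 * (a + b) <= a * b.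
  have := ler_wpM2l (ltW (mulr_gt0 a0 b0)) hab.
  by rewrite mulrDr [a * b * b^-1]mulfK ?gt_eqF// mulrAC mulfV ?gt_eqF//; lra.
have b2 : 0 < b / 2 - 1 by nra.
have h1 := dot_ge0 (u + v - w).
have h2 := dot_ge0 ((b / 2 - 1) *: u - v).
have h3 : 0 <= ((a / 2 - 1) * (b / 2 - 1) - 1) * dot v v.
  by apply: mulr_ge0; [lra|exact: dot_ge0].
(* Completing the square: the quadratic form is first multiplied by [b / 2 - 1], a positive factor
   that is cancelled afterwards. *)
have h4 : 0 <= (b / 2 - 1) * ((b / 2 - 1) * dot u u + (a / 2 - 1) * dot v v
    - 2 * dot u v).
  by move: h2; rewrite !dotE (dotC v u); nra.
rewrite pmulr_rge0 // in h4.
by move: h1; rewrite !dotE (dotC v u) (dotC w u) (dotC w v); lra.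
Qed.

End Dot.

Lemma sigma2_ge0 {R : realType} {d T : nat} (f : 'I_T -> 'rV[R]_d -> R) xs :
  0 <= sigma2 f xs.
Proof.
rewrite mulr_ge0 ?invr_ge0 //.
by apply: sumr_ge0 => t _; exact: exprn_ge0 (enorm_ge0 _).
Qed.

(** * Smooth functions along a line and the Taylor bound *)

Section Smooth.
Context {R : realType} {d : nat}.
Implicit Types (x y z v : 'rV[R]_d) (g : 'rV[R]_d -> R) (L : R).

Lemma derive_grad g x v : differentiable g x -> 'D_v g x = dot (grad g x) v.
Proof.
move=> dg; rewrite deriveE // {1}(row_sum_delta v) linear_sum /=.
apply: eq_bigr => i _.
by rewrite linearZ /= mxE deriveE // mulrC.
Qed.

Lemma is_derive_line g x v (t : R) : (forall y, differentiable g y) ->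
  is_derive t 1 (fun s : R => g (x + s *: v)) (dot (grad g (x + t *: v)) v).
Proof.
move=> dg.
have dl : is_diff t (fun s : R => x + s *: v) (fun s => s *: v).
  have := is_diffD (is_diff_cst x t) (is_diff_scalel t v).
  by move/is_diff_eq; apply; rewrite add0r.
have dlt : differentiable (fun s : R => x + s *: v) t by exact: ex_diff.
have dc : differentiable (g \o (fun s : R => x + s *: v)) t.
  exact: differentiable_comp.
apply: DeriveDef; first exact/derivable1_diffP.
rewrite (deriveE _ dc) diff_comp //=.
by rewrite diff_val scale1r -deriveE // derive_grad.
Qed.

Lemma smooth_grad_dot L g x y : smooth L g ->
  dot (grad g x - grad g y) (grad g x - grad g y)
    <= L ^+ 2 * dot (x - y) (x - y).
Proof.
case=> _ /(_ x y) h; rewrite -!enorm_sqr -exprMn.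
by rewrite lerXn2r ?nnegrE ?enorm_ge0 // (le_trans (enorm_ge0 _) h).
Qed.

(** The mean value theorem is applied on [0, 1] to the linearization error minus its quadratic
    bound, a function with nonpositive derivative; no integration is involved. The sign [e] covers
    both sides of the absolute value at once. *)
Lemma smooth_taylor L g x v : 0 < L -> smooth L g ->
  `|g (x + v) - g x - dot (grad g x) v| <= L / 2 * dot v v.
Proof.
move=> L0 sg; have [dg _] := sg.
have key (e : R) : e ^+ 2 = 1 ->
    e * (g (x + v) - g x - dot (grad g x) v) <= L / 2 * dot v v.
  move=> e1.
  pose h s := e * (g (x + s *: v) - s * dot (grad g x) v)
    - L / 2 * dot v v * s ^+ 2.
  pose dh s := e * (dot (grad g (x + s *: v)) v - dot (grad g x) v)
    - L * dot v v * s.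
  have hd (s : R) : is_derive s 1 h (dh s).
    have hs := is_derive_line g x v s dg.
    have hi := is_derive_id s (1 : R).
    have hl := is_deriveZ (e) (is_deriveB hs (is_deriveZ (dot (grad g x) v) hi)).
    have := is_deriveB hl (is_deriveZ (L / 2 * dot v v) (is_deriveM hi hi)).
    move/is_derive_eq => /(_ (dh s)) hq.
    have -> : h = (e \*: ((fun s : R => g (x + s *: v)) - (dot (grad g x) v) \*: id))
       - (L / 2 * dot v v) \*: (id * id).
      by apply/funext => r; rewrite /h expr2 [r * dot _ _]mulrC.
    by apply: hq; rewrite /dh /GRing.scale /=; lra.
  have hc : {within `[0, 1], continuous h}%classic.
    apply: continuous_subspaceT => s.
    by apply/differentiable_continuous/derivable1_diffP; exact: ex_derive.
  have [c] := MVT ltr01 (fun s _ => hd s) hc.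
  rewrite in_itv /= => /andP[c0 c1].
  rewrite /h /dh scale1r scale0r addr0 !(mul0r, mul1r, subr0, mulr1, expr0n, expr1n, mulr0) /=.
  have := smooth_grad_dot L g (x + c *: v) x sg.
  rewrite addrAC subrr add0r.
  set w := grad g _ - grad g x => hw.
  have -> : dot (grad g (x + c *: v)) v - dot (grad g x) v = dot w v.
    by rewrite !dotE.
  clearbody w.
  (* AM-GM with weight [L c] in place of Cauchy-Schwarz *)
  have Lc : 0 < L * c by exact: mulr_gt0.
  have := dot_ge0 (w - (e * (L * c)) *: v).
  rewrite !dotE (dotC v w) => hh.
  have : 2 * (L * c) * (e * dot w v) <= 2 * (L * c) * (L * c * dot v v).
    move: hw; rewrite !dotE => hw.
    have : (e * (L * c)) * ((e * (L * c)) * dot v v) = (L * c) ^+ 2 * dot v v.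
      by rewrite mulrA -expr2 exprMn e1 mul1r.
    by move: hh hw; set p := dot v v; nra.
  by rewrite ler_pM2l ?mulr_gt0 //; lra.
rewrite ler_norml; apply/andP; split.
  by have := key (-1); rewrite sqrrN expr1n => /(_ erefl); lra.
by have := key 1; rewrite expr1n => /(_ erefl); lra.
Qed.

Lemma convex_functionP g x y (t : R) : convex_function setT g -> 0 <= t <= 1 ->
  g (t *: x + (1 - t) *: y) <= t * g x + (1 - t) * g y.
Proof.
move=> cg /andP[t0 t1].
have := cg (Itv01 t0 t1) x y; rewrite !in_setE => /(_ I I).
by rewrite convRE.
Qed.
End Smooth.

(** * First-order inequalities for a convex smooth function *)

Section Convex.
Context {R : realType} {d : nat} (L : R) (g : 'rV[R]_d -> R).
Hypotheses (L0 : 0 < L) (cg : convex_function setT g) (sg : smooth L g).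
Implicit Types x y z : 'rV[R]_d.

Lemma smooth_le x y :
  g y <= g x + dot (grad g x) (y - x) + L / 2 * dot (y - x) (y - x).
Proof.
have := smooth_taylor L g x (y - x) L0 sg; rewrite [x + _]addrC subrK.
by move=> /(le_trans (ler_norm _)); lra.
Qed.

(** Convexity is used on a short piece of the segment from [x] to [y]: the Taylor error there is of
    second order in [t], so after division by [t] it is at most an arbitrary [e]. *)
Lemma convex_ge x y : g x + dot (grad g x) (y - x) <= g y.
Proof.
apply/ler_addgt0Pr => e e0.
pose q := L / 2 * dot (y - x) (y - x).
have q0 : 0 <= q by rewrite mulr_ge0 ?dot_ge0 // divr_ge0 ?ltW.
(* This choice gives both [t <= 1] and [t * q <= e], also when [q] is 0. *)
pose t := e / (q + e).
have qe : 0 < q + e by rewrite ltr_wpDl.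
have t0 : 0 < t by rewrite divr_gt0.
have t1 : t <= 1 by rewrite ler_pdivrMr // mul1r lerDr.
have tq : t * q <= e by rewrite /t mulrAC ler_pdivrMr // ler_pM2l // lerDl ltW.
have := convex_functionP g y x t cg; rewrite ltW // t1 => /(_ erefl).
have := smooth_taylor L g x (t *: (y - x)) L0 sg.
rewrite ler_norml => /andP[+ _].
have -> : t *: y + (1 - t) *: x = x + t *: (y - x).
  by rewrite scalerBl scalerBr scale1r addrC addrAC addrA.
rewrite dotZr dotZl dotZr [L / 2 * _]mulrCA [L / 2 * _]mulrCA -/q => h1 h2.
have : t * (dot (grad g x) (y - x)) <= t * (g y - g x + t * q) by lra.
by rewrite ler_pM2l //; lra.
Qed.

(** Cocoercivity in terms of function values: the tangent at [x] and the quadratic upper bound at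
    [y] are compared at the point reached from [y] by a step of length [1/L] along [- u]. *)
Lemma convex_smooth_ge x y :
  g x + dot (grad g x) (y - x)
    + (2 * L)^-1 * dot (grad g y - grad g x) (grad g y - grad g x) <= g y.
Proof.
set u := grad g y - grad g x.
have := convex_ge x (y - L^-1 *: u).
have := smooth_le y (y - L^-1 *: u).
have -> : y - L^-1 *: u - y = - L^-1 *: u by rewrite addrAC subrr add0r scaleNr.
have -> : y - L^-1 *: u - x = (y - x) - L^-1 *: u by rewrite addrAC.
have hu : dot (grad g y) u = dot u u + dot (grad g x) u.
  by rewrite -dotDl subrK.
clearbody u; rewrite !(dotDr, dotZr, dotZl, dotNr) hu.
have -> : L / 2 * (- L^-1 * (- L^-1 * dot u u)) = (2 * L)^-1 * dot u u.
  by field; rewrite gt_eqF.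
have : L^-1 * dot u u = 2 * ((2 * L)^-1 * dot u u) by field; rewrite gt_eqF.
by lra.
Qed.

(* Compares a component at two points through the gradient at a third one:
   smoothness between [y] and [e], cocoercivity between [y] and [z]. *)
Lemma convex_smooth_3pt y e z :
  g e - g z <= dot (grad g y) (e - z) + L / 2 * dot (e - y) (e - y)
    - (2 * L)^-1 * dot (grad g y - grad g z) (grad g y - grad g z).
Proof.
have := smooth_le y e; have := convex_smooth_ge y z.
have -> : dot (grad g z - grad g y) (grad g z - grad g y)
  = dot (grad g y - grad g z) (grad g y - grad g z).
  by rewrite -opprB dotNl dotNr opprK.
have -> : e - z = (e - y) - (z - y) by rewrite opprB addrA subrK.
by rewrite [dot _ (_ - (_ - _))]dotDr dotNr; lra.
Qed.

End Convex.

(** * The averaged objective and its minimizer *)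

Section Average.
Context {R : realType} {d T : nat} (L : R) (f : 'I_T -> 'rV[R]_d -> R).
Context (xs : 'rV[R]_d).
Hypotheses (T0 : (0 < T)%N) (L0 : 0 < L).
Hypotheses (cf : forall t, convex_function setT (f t)).
Hypotheses (sf : forall t, smooth L (f t)).
Hypothesis xs_min : is_minimizer (avg f) xs.
Implicit Types x y z : 'rV[R]_d.

Let TR0 : 0 < T%:R :> R. Proof. by rewrite ltr0n. Qed.

Lemma mulT_avg x : T%:R * avg f x = \sum_(t < T) f t x.
Proof. by rewrite /avg mulrA mulfV ?gt_eqF // mul1r. Qed.

Lemma avg_convex x y (t : R) : 0 <= t <= 1 ->
  avg f (t *: x + (1 - t) *: y) <= t * avg f x + (1 - t) * avg f y.
Proof.
move=> t01; rewrite -(ler_pM2l TR0) mulrDr.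
rewrite (mulrCA _ t) (mulrCA _ (1 - t)) !mulT_avg !mulr_sumr.
by rewrite -big_split ler_sum // => i _; apply: convex_functionP.
Qed.

(* A gradient step of length 1/L from the minimizer cannot decrease [avg f]. *)
Lemma sum_grad_min : \sum_(t < T) grad (f t) xs = 0.
Proof.
set G := \sum_(t < T) _.
pose v : 'rV[R]_d := - (L * T%:R)^-1 *: G.
apply: dot_le0; have := xs_min (xs + v).
rewrite -(ler_pM2l TR0) !mulT_avg => h.
have : \sum_(t < T) f t (xs + v) <=
    \sum_(t < T) (f t xs + dot (grad (f t) xs) v + L / 2 * dot v v).
  apply: ler_sum => t _.
  by have := smooth_le L (f t) L0 (sf t) xs (xs + v); rewrite [xs + v - xs]addrAC subrr add0r.
move/(le_trans h).
rewrite !big_split /= -dot_suml -/G sumr_const card_ord -[_ *+ T]mulr_natl /v.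
rewrite !(dotZr, dotZl).
have -> : T%:R * (L / 2 * (- (L * T%:R)^-1 * (- (L * T%:R)^-1 * dot G G))) =
    2^-1 * (L * T%:R)^-1 * dot G G :> R.
  by field; rewrite !gt_eqF.
have LT : 0 < (L * T%:R)^-1 by rewrite invr_gt0 mulr_gt0.
move=> hh; have : (L * T%:R)^-1 * dot G G <= 0 by lra.
by rewrite pmulr_rle0.
Qed.

(** Cocoercivity based at [xs] is summed over the components; the linear terms cancel because the
    gradients at [xs] sum to zero. *)
Lemma sum_grad_sqr_le z :
  \sum_(t < T) dot (grad (f t) z - grad (f t) xs) (grad (f t) z - grad (f t) xs)
    <= 2 * L * T%:R * (avg f z - avg f xs).
Proof.
have L2 : 0 < (2 * L)^-1 by rewrite invr_gt0 mulr_gt0.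
have -> : 2 * L * T%:R * (avg f z - avg f xs) =
    2 * L * (\sum_(t < T) f t z - \sum_(t < T) f t xs).
  by rewrite -!mulT_avg; ring.
rewrite -ler_pdivrMl ?mulr_gt0 // mulr_sumr.
have h : \sum_(t < T) (f t xs + dot (grad (f t) xs) (z - xs)
    + (2 * L)^-1 * dot (grad (f t) z - grad (f t) xs) (grad (f t) z - grad (f t) xs))
    <= \sum_(t < T) f t z.
  by apply: ler_sum => t _; apply: (convex_smooth_ge L (f t)).
move: h; rewrite !big_split /= -dot_suml sum_grad_min dot0l.
by lra.
Qed.

End Average.

(** * Deterministic analysis of one epoch *)

Lemma foldl_map (A B C : Type) (g : A -> B -> A) (h : C -> B) (x : A) (l : seq C) :
  foldl g x (map h l) = foldl (fun y c => g y (h c)) x l.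
Proof. by elim: l x => //= c l IH x; rewrite IH. Qed.

(** Suffix sums appear because an inner iterate is separated from the end of its epoch by the
    gradients still to come. *)
Fixpoint tail_energy {R : realType} {d : nat} {I : Type} (v : I -> 'rV[R]_d)
    (l : seq I) : R :=
  if l is _ :: l' then
    dot (\sum_(i <- l) v i) (\sum_(i <- l) v i) + tail_energy v l'
  else 0.

Section Epoch.
Context {R : realType} {d T : nat} {L : R} {f : 'I_T -> 'rV[R]_d -> R}.
Context {xs : 'rV[R]_d} {alpha beta eta : R}.
Hypotheses (T0 : (0 < T)%N) (L0 : 0 < L).
Hypotheses (cf : forall t, convex_function setT (f t)).
Hypotheses (sf : forall t, smooth L (f t)).
Hypothesis xs_min : is_minimizer (avg f) xs.
Hypotheses (a0 : 0 < alpha) (b0 : 0 < beta).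
Hypothesis ab : alpha^-1 + beta^-1 <= 1 / 2.
Hypotheses (e0 : 0 < eta) (eta_le : eta <= (Num.sqrt beta * T%:R * L)^-1).
Implicit Types (x y z e : 'rV[R]_d) (l : seq 'I_T).

Let TR0 : 0 < T%:R :> R. Proof. by rewrite ltr0n. Qed.

Let igd_step y t := y - eta *: grad (f t) y.

(** Each gradient is taken at its own inner iterate, which the recursion carries along in [x]. *)
Fixpoint grad_dev z x l : seq 'rV[R]_d :=
  if l is t :: l' then (grad (f t) x - grad (f t) z) :: grad_dev z (igd_step x t) l'
  else [::].

(** The reference point [e] will be the end of the epoch; it is shared by all suffixes, so
    inductions keep it fixed. *)
Fixpoint drift e x l : R :=
  if l is t :: l' then dot (x - e) (x - e) + drift e (igd_step x t) l' else 0.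

Let dev2 z x l := \sum_(u <- grad_dev z x l) dot u u.
Let gap2 z l := \sum_(t <- l)
  dot (grad (f t) z - grad (f t) xs) (grad (f t) z - grad (f t) xs).

Lemma size_grad_dev z x l : size (grad_dev z x l) = size l.
Proof. by elim: l x => //= t l IH x; rewrite IH. Qed.

(** Each gradient is split into its deviation from the gradient at [z], the deviation of the latter
    from the gradient at [xs], and the gradient at [xs]; these parts later receive the weights beta,
    alpha and 2. *)
Lemma foldl_igd_step z x l :
  x - foldl igd_step x l = eta *: (\sum_(u <- grad_dev z x l) u
    + \sum_(t <- l) (grad (f t) z - grad (f t) xs)
    + \sum_(t <- l) grad (f t) xs).
Proof.
elim: l x => [|t l IH] x /=; first by rewrite !big_nil !addr0 scaler0 subrr.
have := IH (igd_step x t); set e := foldl _ _ _.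
rewrite !big_cons !scalerDr !scalerN => h.
have -> : x - e = (igd_step x t - e) + eta *: grad (f t) x.
  by apply/rowP => i; rewrite !mxE; ring.
by rewrite h; apply/rowP => i; rewrite !mxE; ring.
Qed.

(** The two deviation sums are bounded crudely, enlarging every suffix to the whole list. The
    gradients at the minimizer keep their suffix sums, so that cancellation under a random order can
    still be exploited. *)
Lemma drift_le z x l : (size l <= T)%N ->
  drift (foldl igd_step x l) x l <=
    eta ^+ 2 * ((size l)%:R * (beta * (T%:R * dev2 z x l)
                               + alpha * (T%:R * gap2 z l))
                + 2 * tail_energy (fun t => grad (f t) xs) l).
Proof.
elim: l x => [|t l IH] x /=; first by rewrite mul0r !mulr0 addr0 mulr0.
move=> lT; have {IH} := IH (igd_step x t) (ltnW lT).
have := foldl_igd_step z x (t :: l); rewrite /=.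
set e := foldl _ _ _ => -> IH.
have := dot_sum_le (grad_dev z x (t :: l)); rewrite size_grad_dev.
have := dot_sum_le (map (fun t => grad (f t) z - grad (f t) xs) (t :: l)).
rewrite size_map !big_map.
have lT' : (size (t :: l))%:R <= T%:R :> R by rewrite ler_nat.
have QQ : dev2 z (igd_step x t) l <= dev2 z x (t :: l).
  by rewrite /dev2 /= big_cons lerDr dot_ge0.
have BB : gap2 z l <= gap2 z (t :: l).
  by rewrite /gap2 /= big_cons lerDr dot_ge0.
have Q0 : 0 <= dev2 z x (t :: l) by apply: sumr_ge0 => ? _; exact: dot_ge0.
have B0 : 0 <= gap2 z (t :: l) by apply: sumr_ge0 => ? _; exact: dot_ge0.
rewrite -/(gap2 z (t :: l)) -/(dev2 z x (t :: l)).
move=> hB hA; rewrite dotZl dotZr mulrA -expr2.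
have := @dot_add3_le R d alpha beta (\sum_(u <- grad_dev z x (t :: l)) u)
  (\sum_(t <- t :: l) (grad (f t) z - grad (f t) xs))
  (\sum_(t <- t :: l) grad (f t) xs) a0 b0 ab.
rewrite -/(grad_dev z x (t :: l)).
set SA := \sum_(u <- grad_dev z x (t :: l)) u.
set SB := \sum_(t <- t :: l) (grad _ z - grad _ xs).
set SC := \sum_(t <- t :: l) grad _ xs.
rewrite -/SA -/SB in hA hB *.
clearbody SA SB SC.
set S := dot (SA + SB + SC) _; clearbody S.
move: (dev2 z x (t :: l)) (gap2 z (t :: l)) QQ BB Q0 B0 hA hB => Q' B' QQ BB Q0 B0 hA hB h3.
have hA' : beta * dot SA SA <= beta * (T%:R * Q').
  by rewrite ler_pM2l // (le_trans hA) // ler_wpM2r.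
have hB' : alpha * dot SB SB <= alpha * (T%:R * B').
  by rewrite ler_pM2l // (le_trans hB) // ler_wpM2r.
have hl : (size l)%:R * (beta * (T%:R * dev2 z (igd_step x t) l)
      + alpha * (T%:R * gap2 z l))
    <= (size l)%:R * (beta * (T%:R * Q') + alpha * (T%:R * B')).
  by apply: ler_wpM2l => //; rewrite lerD // !ler_pM2l.
apply: (le_trans (lerD (lexx _) IH)).
rewrite -mulrDr ler_pM2l ?exprn_gt0 // -natr1.
by move: h3 hA' hB' hl; lra.
Qed.

(** The three-point inequality is summed over the inner steps; the gradients add up to the total
    displacement divided by [eta]. *)
Lemma foldl_igd_gap e z x l :
  \sum_(t <- l) (f t e - f t z) <=
    eta^-1 * dot (x - foldl igd_step x l) (e - z) + L / 2 * drift e x l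
    - (2 * L)^-1 * dev2 z x l.
Proof.
elim: l x => [|t l IH] x /=.
  by rewrite /dev2 /= !big_nil subrr dot0l !mulr0 subr0 addr0.
have := IH (igd_step x t); set y := foldl _ _ _.
rewrite /dev2 /= !big_cons -/(dev2 z _ l) => h.
have := convex_smooth_3pt L (f t) L0 (cf t) (sf t) x e z.
have -> : x - y = (igd_step x t - y) + eta *: grad (f t) x.
  by apply/rowP => i; rewrite !mxE; ring.
have -> : dot (x - e) (x - e) = dot (e - x) (e - x).
  by rewrite -opprB dotNl dotNr opprK.
rewrite [dot (_ - y + _) _]dotDl dotZl [eta^-1 * (_ + _)]mulrDr mulKf ?gt_eqF //.
by lra.
Qed.

(** The two preceding bounds are combined with the end of the epoch as reference point. The step
    size condition makes each deviation term affordable. *)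
Lemma igd_epoch_descent (p : 'S_T) x z (e := igd_epoch f eta p x)
    (gap := fun y => avg f y - avg f xs) :
  gap e + (2 * eta * T%:R)^-1 * dot (e - z) (e - z) <=
    (1 + alpha / beta) * gap z + (2 * eta * T%:R)^-1 * dot (x - z) (x - z)
    + L * eta ^+ 2 / T%:R
      * tail_energy (fun t => grad (f t) xs) (map p (enum 'I_T)).
Proof.
set l := map p (enum 'I_T).
have eE : e = foldl igd_step x l by rewrite [RHS]foldl_map.
have sl : size l = T by rewrite size_map size_enum_ord.
have suml (F : 'I_T -> R) : \sum_(t <- l) F t = \sum_(t < T) F t.
  by rewrite big_map big_enum /= [RHS](reindex_inj (@perm_inj _ p)).
have h1 := foldl_igd_gap e z x l; rewrite -eE suml sumrB -!mulT_avg // in h1.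
have := drift_le z x l; rewrite sl leqnn => /(_ isT); rewrite -eE => h2.
have h3 : gap2 z l <= 2 * L * T%:R * gap z.
  by rewrite /gap2 suml; apply: sum_grad_sqr_le.
have Q0 : 0 <= dev2 z x l by apply: sumr_ge0 => ? _; exact: dot_ge0.
have gz : 0 <= gap z by rewrite subr_ge0.
have eb : eta ^+ 2 * beta * T%:R ^+ 2 * L ^+ 2 <= 1.
  have sb : 0 < Num.sqrt beta by rewrite sqrtr_gt0.
  have : eta * (Num.sqrt beta * T%:R * L) <= 1.
    by rewrite -ler_pdivlMr ?div1r // !mulr_gt0.
  move=> h; have : (eta * (Num.sqrt beta * T%:R * L)) ^+ 2 <= 1.
    by rewrite expr_le1 // !mulr_ge0 // ltW.
  by rewrite !exprMn (sqr_sqrtr (ltW b0)) !mulrA.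
set V := tail_energy _ _ in h2 *.
(* This part of the drift is absorbed by cocoercivity. *)
have hQ : L / 2 * (eta ^+ 2 * (T%:R * (beta * (T%:R * dev2 z x l))))
    <= (2 * L)^-1 * dev2 z x l.
  have -> : L / 2 * (eta ^+ 2 * (T%:R * (beta * (T%:R * dev2 z x l)))) =
     (eta ^+ 2 * beta * T%:R ^+ 2 * L ^+ 2) * ((2 * L)^-1 * dev2 z x l).
    by field; rewrite gt_eqF.
  by apply: ler_piMl => //; rewrite mulr_ge0 // invr_ge0 mulr_ge0 // ltW.
(* This part of the drift is the source of the extra [alpha / beta] in front of [gap z]. *)
have hB : L / 2 * (eta ^+ 2 * (T%:R * (alpha * (T%:R * gap2 z l))))
    <= T%:R * (alpha / beta * gap z).
  apply: (@le_trans _ _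
    (L / 2 * (eta ^+ 2 * (T%:R * (alpha * (T%:R * (2 * L * T%:R * gap z))))))).
    by rewrite !ler_pM2l ?exprn_gt0 ?divr_gt0.
  have -> : L / 2 * (eta ^+ 2 * (T%:R * (alpha * (T%:R * (2 * L * T%:R * gap z)))))
     = (eta ^+ 2 * beta * T%:R ^+ 2 * L ^+ 2) * (T%:R * (alpha / beta * gap z)).
    by field; rewrite gt_eqF.
  by apply: ler_piMl => //; rewrite !mulr_ge0 // ?invr_ge0 ltW.
have hd := ler_wpM2l (ltW (divr_gt0 L0 (ltr0Sn R 1))) h2.
(* Polarization, with the negative term in [x - e] dropped. *)
have h4 : dot (x - e) (e - z) <= (dot (x - z) (x - z) - dot (e - z) (e - z)) / 2.
  have := dot_ge0 (x - e).
  have -> : x - z = (x - e) + (e - z) by rewrite addrA subrK.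
  set u := x - e; set v := e - z; clearbody u v.
  by rewrite !dotE (dotC v u); lra.
have h5 : eta^-1 * dot (x - e) (e - z) <=
    eta^-1 * ((dot (x - z) (x - z) - dot (e - z) (e - z)) / 2).
  by rewrite ler_pM2l ?invr_gt0.
have h6 : T%:R * gap e - T%:R * gap z = T%:R * avg f e - T%:R * avg f z.
  by rewrite /gap; ring.
rewrite -h6 in h1; rewrite -(ler_pM2l TR0).
clearbody V gap.
have -> : T%:R * (gap e + (2 * eta * T%:R)^-1 * dot (e - z) (e - z)) =
    T%:R * gap e + eta^-1 * dot (e - z) (e - z) / 2.
  by field; rewrite !gt_eqF.
have -> : T%:R * ((1 + alpha / beta) * gap z
      + (2 * eta * T%:R)^-1 * dot (x - z) (x - z) + L * eta ^+ 2 / T%:R * V) =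
    T%:R * gap z + T%:R * (alpha / beta * gap z)
      + eta^-1 * dot (x - z) (x - z) / 2 + L * eta ^+ 2 * V.
  by field; rewrite !gt_eqF.
by move: h1 hd hQ hB h5; lra.
Qed.

End Epoch.

(* [last_weight a m] is the ratio between the weight of the epoch followed by
   [m] further epochs and the weight of the last epoch. *)
Fixpoint last_weight {R : realType} (a : R) (m : nat) : R :=
  if m is m'.+1 then
    (1 + a) * m%:R / (1 + (1 + a) * m%:R) * last_weight a m'
  else 1.

(** * Last iterate of an abstract noisy descent step *)

Section LastIterate.
Context {R : realType} {d : nat} {P : Type}.
Context {step : P -> 'rV[R]_d -> 'rV[R]_d} {gap : 'rV[R]_d -> R} {W : P -> R}.
Context {a c : R}.
Hypotheses (a0 : 0 < a) (c0 : 0 < c).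
Hypothesis gap_convex : forall x y (t : R), 0 <= t <= 1 ->
  gap (t *: x + (1 - t) *: y) <= t * gap x + (1 - t) * gap y.
Hypothesis gap_step : forall p x z,
  gap (step p x) + c * dot (step p x - z) (step p x - z) <=
    (1 + a) * gap z + c * dot (x - z) (x - z) + W p.
Implicit Types (x z : 'rV[R]_d) (l : seq P).

Fixpoint weighted_noise l : R :=
  if l is p :: l' then last_weight a (size l') * W p + weighted_noise l' else 0.

Lemma last_weight_ge0 m : 0 <= last_weight a m.
Proof.
elim: m => [|m IH]; first exact: ler01.
have h : 0 <= (1 + a) * m.+1%:R :> R by rewrite mulr_ge0 // addr_ge0 // ltW.
by rewrite /last_weight -/last_weight mulr_ge0 // divr_ge0 // addr_ge0.
Qed.

(* The comparison point [z] is moved towards the current iterate before every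
   epoch; the step [1 / (1 + (1 + a) m)] makes the gaps of all iterates but the
   last one cancel. *)
Lemma gap_foldl_le x z l :
  gap (foldl (fun y p => step p y) x l) <=
    last_weight a (size l) * ((size l)%:R * (1 + a) * gap z + gap x
                              + c * dot (x - z) (x - z))
    + weighted_noise l.
Proof.
elim: l x z => [|p l IH] x z.
  rewrite /= mul1r !mul0r add0r addr0 lerDl.
  by rewrite mulr_ge0 ?dot_ge0 // ltW.
set m := (size l).+1%:R : R.
pose s := 1 + (1 + a) * m.
have m0 : 0 < m by rewrite ltr0n.
have s1 : 1 <= s by rewrite lerDl mulr_ge0 // ?addr_ge0 // ltW.
have s0 : 0 < s by apply: lt_le_trans s1.
pose t := s^-1.
have t01 : 0 <= t <= 1 by rewrite invr_ge0 ltW //= invf_le1.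
pose z' := t *: x + (1 - t) *: z.
have ht : (1 + a) * m / (1 + (1 + a) * m) = 1 - t.
  have -> : (1 + a) * m = s - 1 by rewrite /s [1 + _ * _]addrC addrK.
  by rewrite [1 + (s - 1)]addrC subrK mulrBl mul1r divff ?gt_eqF.
(* The choice of [t] makes the share of [gap x] in the bound on [m * (1 + a) * gap z'] equal to
   [1 - t], the ratio of consecutive weights. *)
have ht' : m * (1 + a) * t = 1 - t by rewrite -ht mulrC [m * _]mulrC mulrC.
have /= := IH (step p x) z'; rewrite -/m.
set F := foldl _ _ _ => /le_trans; apply.
rewrite addrA lerD2r ht; set w := last_weight a _.
rewrite [leRHS](_ : _ = w * ((1 - t) * (m * (1 + a) * gap z + gap x
  + c * dot (x - z) (x - z)) + W p)); last by ring.
rewrite ler_wpM2l ?last_weight_ge0 //.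
have h1 := gap_step p x z'.
have h2 := gap_convex x z t t01.
have h3 : dot (x - z') (x - z') <= (1 - t) * dot (x - z) (x - z).
  have -> : x - z' = (1 - t) *: (x - z) by apply/rowP => i; rewrite !mxE; ring.
  rewrite dotZl dotZr ler_wpM2l //; first by case/andP: t01; lra.
  by rewrite ler_piMl ?dot_ge0 //; case/andP: t01; lra.
have h4 : c * dot (x - z') (x - z') <= c * ((1 - t) * dot (x - z) (x - z)).
  by rewrite ler_pM2l.
have h5 : m * (1 + a) * gap z' <= m * (1 + a) * (t * gap x + (1 - t) * gap z).
  by rewrite ler_wpM2l // mulr_ge0 // ?addr_ge0 // ltW.
have h6 : m * (1 + a) * (t * gap x + (1 - t) * gap z) =
    (1 - t) * gap x + (1 - t) * (m * (1 + a) * gap z).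
  by rewrite mulrDr mulrA ht'; ring.
have : (size l)%:R = m - 1 by rewrite /m -natr1 addrK.
move=> ->; move: h1 h4 h5; rewrite h6.
by lra.
Qed.

(** The first epoch is compared with [xs] itself, whose gap vanishes; only the initial distance and
    the noise survive. *)
Lemma last_iterate_le x xs p l : gap xs = 0 ->
  gap (foldl (fun y q => step q y) x (p :: l)) <=
    last_weight a (size l) * (c * dot (x - xs) (x - xs)) + weighted_noise (p :: l).
Proof.
move=> g0 /=; apply: le_trans (gap_foldl_le (step p x) xs l) _.
rewrite addrA lerD2r -mulrDr ler_wpM2l ?last_weight_ge0 //.
by have := gap_step p x xs; rewrite g0 !mulr0 !add0r.
Qed.

End LastIterate.

(** * Power bounds on the weights *)

Section LastWeight.
Context {R : realType}.

(** Convexity of the exponential between [ln y] and 0. The case [y = 0], where [ln] is a default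
    value, is treated apart; it is reached below when [K] is 0. *)
Lemma powR_bernoulli (y b : R) : 0 <= y -> 0 < b -> b <= 1 ->
  y `^ b <= 1 + b * (y - 1).
Proof.
move=> y0 b0 b1; move: y0; rewrite le_eqVlt => /orP[/eqP <-|y0].
  by rewrite powR0 ?gt_eqF //; lra.
have : expR (b * ln y + (1 - b) * 0) <= b * expR (ln y) + (1 - b) * expR 0.
  exact: convex_expR (Itv01 (ltW b0) b1) (ln y) 0.
rewrite mulr0 addr0 expR0 lnK // /powR gt_eqF // => /le_trans; apply.
by lra.
Qed.

Context {a : R}.
Hypothesis a0 : 0 < a.
Let b := (1 + a)^-1.
Let a1 : 0 < 1 + a. Proof. by rewrite addr_gt0. Qed.
Let b0 : 0 < b. Proof. by rewrite invr_gt0. Qed.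
Let b1 : b < 1. Proof. by rewrite invf_lt1 // ltrDl. Qed.

(** Each factor equals [1 / (1 + b/m)], and Bernoulli bounds [((m+1)/m) ^ b] by [1 + b/m], so the
    product telescopes. *)
Lemma last_weight_le m : last_weight a m <= (m.+1%:R `^ b)^-1.
Proof.
elim: m => [|m IH]; first by rewrite powR1 invr1.
have m0 : 0 < m.+1%:R :> R by rewrite ltr0n.
have p1 : 0 < m.+1%:R `^ b by rewrite powR_gt0.
have p2 : 0 < m.+2%:R `^ b by rewrite powR_gt0.
rewrite /last_weight -/last_weight.
have -> : (1 + a) * m.+1%:R / (1 + (1 + a) * m.+1%:R) = m.+1%:R / (b + m.+1%:R).
  by rewrite /b; field; rewrite !gt_eqF // ?addr_gt0 ?mulr_gt0 // invr_gt0.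
have bm : 0 < b + m.+1%:R by rewrite addr_gt0.
apply: (le_trans (ler_wpM2l _ IH)); first by rewrite divr_ge0 ?ltW.
rewrite -mulrA -invfM ler_pdivrMr ?mulr_gt0 // ler_pdivlMl //.
have -> : m.+2%:R = m.+1%:R * (m.+2%:R / m.+1%:R) :> R.
  by rewrite mulrC divfK ?gt_eqF.
rewrite powRM ?divr_ge0 // -mulrA [leRHS]mulrC ler_pM2l //.
have q0 : 0 <= m.+2%:R / m.+1%:R :> R by rewrite divr_ge0.
apply: (le_trans (ler_wpM2r (ltW m0) (powR_bernoulli _ _ q0 b0 (ltW b1)))).
rewrite -(natr1 m.+1); move: (m.+1%:R) m0 => q m0.
have -> : (1 + b * ((q + 1) / q - 1)) * q = b + q by field; rewrite gt_eqF.
exact: lexx.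
Qed.

(** A discrete integral comparison: Bernoulli with exponent [1 - b] shows that the right side grows
    by at least the new term. *)
Lemma sum_last_weight_le K :
  \sum_(m < K) last_weight a m <= (1 - b)^-1 * K%:R `^ (1 - b).
Proof.
have c0 : 0 < 1 - b by rewrite subr_gt0.
have c1 : 1 - b <= 1 by rewrite gerBl ltW.
elim: K => [|K IH]; first by rewrite big_ord0 mulr_ge0 ?powR_ge0 // invr_ge0 ltW.
rewrite big_ord_recr /=; apply: (le_trans (lerD IH (last_weight_le K))).
rewrite -(ler_pM2l c0) mulrDr !mulrA mulfV ?gt_eqF // !mul1r.
have k0 : 0 < K.+1%:R :> R by rewrite ltr0n.
have -> : (K.+1%:R `^ b)^-1 = K.+1%:R `^ (1 - b) / K.+1%:R.
  rewrite powRB; last by apply/implyP => _; rewrite gt_eqF.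
  by rewrite powRr1 ?ltW // mulrAC mulfV ?gt_eqF // mul1r.
have -> : K%:R = K.+1%:R * (K%:R / K.+1%:R) :> R.
  by rewrite mulrC divfK ?gt_eqF.
rewrite powRM ?divr_ge0 //.
set P := K.+1%:R `^ (1 - b).
have P0 : 0 <= P by exact: powR_ge0.
have kk : 0 <= K%:R / K.+1%:R :> R by rewrite divr_ge0.
have := ler_wpM2l P0 (powR_bernoulli _ _ kk c0 c1).
have -> : K%:R / K.+1%:R - 1 = - K.+1%:R^-1 :> R.
  by rewrite -natr1; field; rewrite natr1 gt_eqF.
move: (K.+1%:R^-1) => q.
by lra.
Qed.

End LastWeight.

(** * Sampling without replacement *)

Section Permutations.
Context {R : realType} {d T : nat}.
Local Notation N := (#|{perm 'I_T}|%:R : R).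

Lemma sum_perm (V : nmodType) (F : 'I_T -> V) (p : 'S_T) :
  \sum_(t < T) F (p t) = \sum_(t < T) F t.
Proof. by rewrite [RHS](reindex_inj (@perm_inj _ p)). Qed.

(** Composition with a transposition shows that all positions have the same law; summing over
    positions then removes the permutation. *)
Lemma sum_perm_at (h : 'I_T -> R) (i : 'I_T) :
  \sum_(p : 'S_T) h (p i) = N * (T%:R^-1 * \sum_(t < T) h t).
Proof.
have T0 : 0 < T%:R :> R by rewrite ltr0n (leq_ltn_trans _ (ltn_ord i)).
have ij j : \sum_(p : 'S_T) h (p i) = \sum_(p : 'S_T) h (p j).
  rewrite (reindex_inj (mulgI (tperm i j))) /=.
  by apply: eq_bigr => p _; rewrite permM tpermL.
apply: (mulfI (lt0r_neq0 T0)).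
have -> : T%:R * \sum_(p : 'S_T) h (p i) = \sum_(j < T) \sum_(p : 'S_T) h (p j).
  by rewrite (eq_bigr _ (fun j _ => esym (ij j))) sumr_const card_ord mulr_natl.
rewrite exchange_big /=.
rewrite (eq_bigr _ (fun p _ => sum_perm _ h p)).
by rewrite sumr_const -[_ *+ #|_|]mulr_natl [RHS]mulrCA mulVKf ?lt0r_neq0.
Qed.

Context {v : 'I_T -> 'rV[R]_d}.
Hypothesis v0 : \sum_(t < T) v t = 0.
Let s2 := T%:R^-1 * \sum_(t < T) dot (v t) (v t).

(** Distinct positions are negatively correlated: the sums [Q k] with [k != i] all agree, [Q i] is
    nonnegative, and the total is zero because [v] sums to zero. *)
Lemma sum_perm_cross_le0 (i j : 'I_T) : i != j ->
  \sum_(p : 'S_T) dot (v (p i)) (v (p j)) <= 0.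
Proof.
move=> ij; rewrite leNgt; apply/negP => Q0.
pose Q k := \sum_(p : 'S_T) dot (v (p i)) (v (p k)).
have QE k : k != i -> Q k = Q j.
  move=> ki; rewrite /Q (reindex_inj (mulgI (tperm j k))) /=.
  by apply: eq_bigr => p _; rewrite !permM tpermR tpermD // eq_sym.
have : \sum_(k < T) Q k = 0.
  rewrite exchange_big big1 // => p _.
  rewrite -dot_sumr (sum_perm _ v p) v0.
  by rewrite dotC dot0l.
rewrite (bigD1 i) //= (bigD1 j) /=; last by rewrite eq_sym.
have Qi : 0 <= Q i by apply: sumr_ge0 => p _; exact: dot_ge0.
have : 0 <= \sum_(k < T | (k != i) && (k != j)) Q k.
  by apply: sumr_ge0 => k /andP[ki _]; rewrite QE // ltW.
by have : 0 < Q j by []; lra.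
Qed.

Lemma sum_perm_sum_le (l : seq 'I_T) : uniq l ->
  \sum_(p : 'S_T) dot (\sum_(i <- map p l) v i) (\sum_(i <- map p l) v i)
    <= (size l)%:R * (N * s2).
Proof.
elim: l => [|i l IH] /=.
  by move=> _; rewrite big1 ?mul0r // => p _; rewrite big_nil dot0l.
case/andP => il /IH {}IH.
have cross : \sum_(p : 'S_T) dot (v (p i)) (\sum_(j <- map p l) v j) <= 0.
  under eq_bigr => p _ do rewrite big_map dot_sumr.
  rewrite exchange_big /= big_seq sumr_le0 // => j jl.
  by apply: sum_perm_cross_le0; apply: contraNneq il => ->.
have diag := sum_perm_at (fun t => dot (v t) (v t)) i.
under eq_bigr => p _ do
  rewrite big_cons !dotE [dot (\sum_(j <- _) _) (v _)]dotC.
by rewrite !big_split /= -natr1 mulrDl mul1r; move: IH cross; rewrite diag -/s2; lra.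
Qed.

(** A suffix of size m contributes at most m times the variance, and the sizes 1 to n add up to at
    most [n ^ 2]. *)
Lemma sum_perm_tail_energy_le (l : seq 'I_T) : uniq l ->
  \sum_(p : 'S_T) tail_energy v (map p l) <= (size l)%:R ^+ 2 * (N * s2).
Proof.
have Ns : 0 <= N * s2.
  rewrite mulr_ge0 // mulr_ge0 ?invr_ge0 //.
  by apply: sumr_ge0 => t _; exact: dot_ge0.
elim: l => [|i l IH] ul /=; first by rewrite big1 ?expr0n ?mul0r.
have /andP[_ /IH {}IH] := ul.
have h := sum_perm_sum_le _ ul; rewrite /= in h.
rewrite big_split /=; apply: (le_trans (lerD h IH)).
rewrite -mulrDl ler_wpM2r // -natr1.
have : 0 <= (size l)%:R :> R by [].
by move: (_%:R) => n n0; nra.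
Qed.

End Permutations.

(** * Expectation over the shuffles *)

Section Expectation.
Context {R : realType} {s : shuffling} {T K : nat}.
Implicit Types g h : ('I_K -> 'S_T) -> R.
Local Notation E := (@shuffle_expectation R s T K).
Local Notation N := (#|{perm 'I_T}|%:R : R).

Let N0 : 0 < N.
Proof. by rewrite ltr0n; apply/card_gt0P; exists 1%g. Qed.

Lemma expectation_mono g h : (forall pi, g pi <= h pi) -> E g <= E h.
Proof.
move=> gh; rewrite /shuffle_expectation; case: s; apply: ler_sum => pi _;
  by rewrite ler_wpM2l // ?prodr_ge0 // => *; rewrite invr_ge0 ltW.
Qed.

Lemma expectationD g h : E (fun pi => g pi + h pi) = E g + E h.
Proof.
rewrite /shuffle_expectation; case: s; rewrite -big_split; apply: eq_bigr => pi _;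
  by rewrite mulrDr.
Qed.

Lemma expectationZ (r : R) g : E (fun pi => r * g pi) = r * E g.
Proof.
rewrite /shuffle_expectation; case: s; rewrite mulr_sumr; apply: eq_bigr => pi _;
  by rewrite mulrCA.
Qed.

(** Under both schemes the permutation of a single epoch is uniform. For reshuffling the sum of
    products factors, and every factor other than the one at [k] sums to 1. *)
Lemma expectation_marginal (h : 'S_T -> R) (k : 'I_K) :
  E (fun pi => h (pi k)) = N^-1 * \sum_(p : 'S_T) h p.
Proof.
rewrite /shuffle_expectation; case: s; last by rewrite mulr_sumr.
pose F (i : 'I_K) (p : 'S_T) : R := N^-1 * (if i == k then h p else 1).
have -> : \sum_(pi : {ffun 'I_K -> 'S_T}) \prod_(i < K) N^-1 * h (pi k) =
    \sum_(pi : {ffun 'I_K -> 'S_T}) \prod_(i < K) F i (pi i).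
  apply: eq_bigr => pi _; rewrite big_split /=; congr (_ * _).
  by rewrite -big_mkcond big_pred1_eq.
rewrite -bigA_distr_bigA (bigD1 k) //= [X in _ * X]big1 => [|i /negbTE ik].
  by rewrite mulr1 /F eqxx mulr_sumr.
by rewrite /F ik -mulr_sumr sumr_const mulVf // lt0r_neq0.
Qed.

Lemma expectation_cst (k : 'I_K) (r : R) : E (fun=> r) = r.
Proof.
rewrite (expectation_marginal (fun=> r) k) sumr_const -[r *+ _]mulr_natl mulKf //.
by rewrite lt0r_neq0.
Qed.

End Expectation.

(** * The bound on the expected gap *)

Section ExpectedGap.
Context {R : realType}.

(** The noise is a sum of terms that each see one epoch, so marginal laws suffice and both schemes
    give the same bound. *)
Lemma expected_weighted_noise_le (s : shuffling) (T K : nat) (W : 'S_T -> R)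
    (a w : R) (l : seq 'I_K) : 0 < a ->
  #|{perm 'I_T}|%:R^-1 * \sum_(p : 'S_T) W p <= w ->
  shuffle_expectation s
    (fun pi : 'I_K -> 'S_T => weighted_noise (W := W) (a := a) (map pi l))
    <= w * \sum_(m < size l) last_weight a m.
Proof.
move=> a0 hw; elim: l => [|k l IH] /=.
  rewrite big_ord0 mulr0 /shuffle_expectation.
  by case: s; rewrite big1 // => *; rewrite mulr0.
rewrite expectationD big_ord_recr /= mulrDr addrC lerD //.
have -> : (fun pi : 'I_K -> 'S_T => last_weight a (size (map pi l)) * W (pi k)) =
    (fun pi => last_weight a (size l) * W (pi k)).
  by apply/funext => pi; rewrite size_map.
rewrite expectationZ (expectation_marginal W k) mulrC ler_wpM2r //.
exact: last_weight_ge0.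
Qed.

Lemma expected_gap_le (s : shuffling) (d T : nat) (L : R)
    (f : 'I_T -> 'rV[R]_d -> R) (xs x0 : 'rV[R]_d) (alpha beta eta : R) (K : nat) :
  (0 < T)%N -> 0 < L ->
  (forall t, convex_function setT (f t)) ->
  (forall t, smooth L (f t)) ->
  is_minimizer (avg f) xs ->
  0 < alpha -> 0 < beta -> alpha^-1 + beta^-1 <= 1 / 2 ->
  0 < eta -> eta <= (Num.sqrt beta * T%:R * L)^-1 ->
  (0 < K)%N ->
  expected_gap s f xs x0 eta K <=
    eta ^+ 2 * sigma2 f xs * T%:R * L * (1 + beta / alpha)
      * K%:R `^ ((alpha / beta) / (1 + alpha / beta))
    + enorm (x0 - xs) ^+ 2
      / (2 * T%:R * eta * K%:R `^ (1 / (1 + alpha / beta))).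
Proof.
move=> T0 L0 cf sf xs_min a0 b0 ab e0 eta_le K0.
set a := alpha / beta.
have apos : 0 < a by rewrite divr_gt0.
have TR0 : 0 < T%:R :> R by rewrite ltr0n.
pose gap y := avg f y - avg f xs.
pose V (p : 'S_T) := tail_energy (fun t => grad (f t) xs) (map p (enum 'I_T)).
pose W p := L * eta ^+ 2 / T%:R * V p.
pose c := (2 * eta * T%:R)^-1.
have c0 : 0 < c by rewrite invr_gt0 !mulr_gt0.
have gconv x y t : 0 <= t <= 1 ->
    gap (t *: x + (1 - t) *: y) <= t * gap x + (1 - t) * gap y.
  by move=> t01; have := avg_convex f T0 cf x y t t01; rewrite /gap; lra.
have gstep p x z := igd_epoch_descent T0 L0 cf sf xs_min a0 b0 ab e0 eta_le p x z.
have gxs : gap xs = 0 by rewrite /gap subrr.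
have Nn : #|{perm 'I_T}|%:R != 0 :> R.
  by rewrite lt0r_neq0 // ltr0n; apply/card_gt0P; exists 1%g.
have EW : #|{perm 'I_T}|%:R^-1 * \sum_(p : 'S_T) W p
    <= L * eta ^+ 2 * T%:R * sigma2 f xs.
  have sg0 := sum_grad_min L f xs T0 L0 sf xs_min.
  have := sum_perm_tail_energy_le sg0 (enum 'I_T) (enum_uniq _).
  rewrite size_enum_ord -mulr_sumr => h.
  rewrite mulrCA.
  apply: (@le_trans _ _ (L * eta ^+ 2 / T%:R * (#|{perm 'I_T}|%:R^-1
      * (T%:R ^+ 2 * (#|{perm 'I_T}|%:R * sigma2 f xs))))).
    rewrite ler_wpM2l ?divr_ge0 ?mulr_ge0 ?exprn_ge0 ?(ltW L0) ?(ltW e0) //.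
    rewrite ler_wpM2l ?invr_ge0 //.
    by rewrite /sigma2 (eq_bigr _ (fun t _ => enorm_sqr (grad (f t) xs))).
  by rewrite le_eqVlt; apply/orP; left; apply/eqP; field; rewrite Nn gt_eqF.
(* The last-iterate bound holds for every realization; [K.-1] counts the epochs after the first. *)
have Eb (pi : 'I_K -> 'S_T) : gap (igd f eta x0 pi) <=
    last_weight a K.-1 * (c * dot (x0 - xs) (x0 - xs))
    + weighted_noise (W := W) (a := a) (map pi (enum 'I_K)).
  have -> : igd f eta x0 pi =
      foldl (fun x p => igd_epoch f eta p x) x0 (map pi (enum 'I_K)).
    by rewrite [RHS]foldl_map.
  have : size (map pi (enum 'I_K)) = K by rewrite size_map size_enum_ord.
  case: (map pi (enum 'I_K)) => [sK|p l <-]; first by rewrite -sK in K0.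
  exact: (last_iterate_le (W := W) apos c0 gconv gstep).
apply: (le_trans (expectation_mono _ _ Eb)).
rewrite expectationD (expectation_cst (Ordinal K0)) addrC.
have := expected_weighted_noise_le s T K W a _ (enum 'I_K) apos EW.
rewrite size_enum_ord.
have w0 : 0 <= L * eta ^+ 2 * T%:R * sigma2 f xs.
  by rewrite mulr_ge0 ?sigma2_ge0 // !mulr_ge0 ?exprn_ge0 ?(ltW L0) ?(ltW e0).
move/le_trans => /(_ _ (ler_wpM2l w0 (sum_last_weight_le apos K))) hn.
have a1 : 1 + a != 0 by rewrite gt_eqF // addr_gt0.
apply: lerD.
  apply: (le_trans hn).
  have -> : 1 - (1 + a)^-1 = a / (1 + a) by field.
  have -> : (a / (1 + a))^-1 = 1 + beta / alpha.
    by rewrite /a; field; rewrite !gt_eqF // addr_gt0.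
  by rewrite le_eqVlt; apply/orP; left; apply/eqP; ring.
have := last_weight_le apos K.-1; rewrite prednK // => hw.
have hD : 0 <= c * dot (x0 - xs) (x0 - xs) by rewrite mulr_ge0 ?dot_ge0 ?(ltW c0).
apply: (le_trans (ler_wpM2r hD hw)).
have P0 : K%:R `^ (1 + a)^-1 != 0 :> R.
  by rewrite gt_eqF // powR_gt0 // ltr0n.
rewrite enorm_sqr div1r /c.
by rewrite le_eqVlt; apply/orP; left; apply/eqP; field; rewrite P0 !gt_eqF.
Qed.

End ExpectedGap.

(** * Choice of the number of epochs and of the step size *)

Section EpochCount.
Context {R : realType}.

Lemma expR1_ge2 : 2 <= expR 1 :> R.
Proof. by have := expR_ge1Dx (1 : R); lra. Qed.

(** For alpha = 4 and beta = 4 log K the ratio alpha / beta is [1 / ln K], and [K ^ (1 / ln K)] is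
    e; both powers of [K] in the bound thus cost only constants. *)
Lemma powR_inv_ln_le (x : R) (a := (ln x)^-1) : 0 < x -> 1 <= ln x ->
  x `^ (a / (1 + a)) <= expR 1 /\ x <= expR 1 * x `^ (1 / (1 + a)).
Proof.
move=> x0 l1.
have l0 : 0 < ln x by exact: lt_le_trans l1.
have a0 : 0 < a by rewrite invr_gt0.
have h : x `^ (a / (1 + a)) <= expR 1.
  rewrite /powR gt_eqF // ler_expR mulrAC mulVf ?gt_eqF // mul1r.
  by rewrite invf_le1 ?addr_gt0 // lerDl ltW.
split=> //.
have -> : 1 / (1 + a) = 1 - a / (1 + a) by field; rewrite gt_eqF ?addr_gt0.
rewrite powRB; last by apply/implyP => _; rewrite gt_eqF.
rewrite powRr1 ?(ltW x0) // mulrA ler_pdivlMr ?powR_gt0 // mulrC.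
by rewrite ler_wpM2r // ltW.
Qed.

Lemma epoch_count_exists (T : nat) (X : R) (lam := ln (expR 1 + X)) :
  (0 < T)%N -> T%:R <= X ->
  exists K : nat, [/\ 1 <= ln (K%:R : R),
    2 * expR 1 ^+ 2 * Num.sqrt (ln (K%:R : R)) * X <= T%:R * K%:R &
    T%:R * K%:R <= expR 7 * X * lam].
Proof.
move=> T0 TX.
have TR1 : 1 <= T%:R :> R by rewrite ler1n.
have TR0 : 0 < T%:R :> R by rewrite ltr0n.
have X0 : 0 < X by exact: lt_le_trans TX.
have eX : 0 < expR 1 + X by rewrite addr_gt0 ?expR_gt0.
have lam1 : 1 <= lam.
  by rewrite -ler_expR lnK // lerDl ltW.
have lam0 : 0 < lam by exact: lt_le_trans lam1.
set Y := X / T%:R.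
have Y1 : 1 <= Y by rewrite ler_pdivlMr // mul1r.
have YX : Y <= X by rewrite ler_pdivrMr // ler_peMr // ltW.
have TY : T%:R * Y = X by rewrite /Y mulrCA mulfV ?mulr1 // gt_eqF.
have Yl : 1 <= Y * lam by rewrite mulr_ege1.
(* Two of the six powers of e occur in the requirement; the other four absorb the factor 6, which
   comes from 2 and from [sqrt (ln K) <= 3 * lam]. Rounding up costs one more power, since
   [Y * lam >= 1]. *)
pose y := expR 6 * (Y * lam).
have e2 := expR1_ge2.
have e6 : 1 <= expR 6 :> R by rewrite -expR0 ler_expR.
have e7 : expR 6 + 1 <= expR 7 :> R.
  have -> : expR 7 = expR 6 * expR 1 :> R by rewrite -expRD; congr expR; lra.
  by nra.
have y0 : 0 <= y by rewrite mulr_ge0 ?expR_ge0 // (le_trans ler01).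
have yge : expR 6 <= y by rewrite ler_peMr ?expR_ge0.
exists (Num.truncn y).+1.
set K := _.+1.
have yK : y < K%:R by exact: truncnS_gt.
have K0 : 0 < K%:R :> R by rewrite ltr0n.
have Ky : K%:R <= expR 7 * (Y * lam).
  have : K%:R <= y + 1 by rewrite -natr1 lerD2r truncn_le.
  by rewrite /y; nra.
have lnK_ge : 6 <= ln (K%:R : R).
  by rewrite -ler_expR lnK // (le_trans yge) // ltW.
split; first by apply: le_trans lnK_ge; lra.
- have lnK_le : ln (K%:R : R) <= 9 * lam.
    rewrite -ler_expR lnK //.
    (* Both [Y] and [lam] are at most [expR lam]. *)
    apply: (le_trans Ky); apply: (@le_trans _ _ (expR (7 + (lam + lam)))).
      rewrite !expRD ler_pM2l ?expR_gt0 // ler_pM ?(le_trans ler01) //.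
        by rewrite lnK // (le_trans YX) // lerDr expR_ge0.
      by have := expR_ge1Dx lam; lra.
    by rewrite ler_expR; lra.
  have sq : Num.sqrt (ln (K%:R : R)) <= 3 * lam.
    rewrite -[leRHS]ger0_norm; last by rewrite mulr_ge0 ?ltW.
    by rewrite -sqrtr_sqr ler_sqrt ?sqr_ge0 //; nra.
  apply: (@le_trans _ _ (T%:R * y)); last by rewrite ler_pM2l // ltW.
  have -> : T%:R * y = expR 6 * (X * lam) by rewrite /y -TY; ring.
  have -> : expR 6 = expR 1 ^+ 6 :> R by rewrite -expRM_natl mulr1.
  have : 2 * expR 1 ^+ 2 * X * Num.sqrt (ln (K%:R : R))
      <= 2 * expR 1 ^+ 2 * X * (3 * lam).
    by rewrite ler_wpM2l // !mulr_ge0 ?exprn_ge0 ?expR_ge0 // ltW.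
  have e4 : 6 <= expR 1 ^+ 4 :> R.
    have : 2 ^+ 4 <= expR 1 ^+ 4 :> R by rewrite lerXn2r ?nnegrE ?expR_ge0.
    by lra.
  have : 6 * (expR 1 ^+ 2 * (X * lam)) <= expR 1 ^+ 4 * (expR 1 ^+ 2 * (X * lam)).
    by rewrite ler_wpM2r // !mulr_ge0 ?exprn_ge0 ?expR_ge0 // ltW.
  by lra.
- have -> : expR 7 * X * lam = T%:R * (expR 7 * (Y * lam)) by rewrite -TY; ring.
  by rewrite ler_pM2l.
Qed.

End EpochCount.

(** The step size makes the noise term at most [eps / 2]; the assumed number of epochs does the same
    for the distance term. *)
Lemma constant_step_gap_le (R : realType) (s : shuffling) (d T : nat) (L : R)
    (f : 'I_T -> 'rV[R]_d -> R) (xs x0 : 'rV[R]_d) (eps : R) (K : nat) :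
  (0 < T)%N -> 0 < L ->
  (forall t, convex_function setT (f t)) ->
  (forall t, smooth L (f t)) ->
  is_minimizer (avg f) xs ->
  0 < eps -> 1 <= ln (K%:R : R) ->
  2 * expR 1 ^+ 2 * Num.sqrt (ln (K%:R : R)) * complexity L f xs x0 eps
    <= T%:R * K%:R ->
  exists eta : R, [/\ 0 < eta,
    eta <= (Num.sqrt (4 * ln (K%:R : R)) * T%:R * L)^-1 &
    expected_gap s f xs x0 eta K <= eps].
Proof.
move=> T0 L0 cf sf xs_min eps0 l1 hK.
have TR0 : 0 < T%:R :> R by rewrite ltr0n.
(* Since [ln 0] is 0 by convention, [l1] excludes [K = 0]. *)
have K0 : (0 < K)%N.
  by rewrite lt0n; apply: contraTneq l1 => ->; rewrite ln0 // -ltNge ltr01.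
have KR0 : 0 < K%:R :> R by rewrite ltr0n.
set l := ln (K%:R : R) in l1 hK *.
have l0 : 0 < l by exact: lt_le_trans l1.
set r := Num.sqrt l in hK.
have r0 : 0 < r by rewrite sqrtr_gt0.
have r2 : r ^+ 2 = l by rewrite sqr_sqrtr ?ltW.
set q := Num.sqrt eps.
have q0 : 0 < q by rewrite sqrtr_gt0.
have q2 : q ^+ 2 = eps by rewrite sqr_sqrtr ?ltW.
have TL0 : 0 < T%:R * L by rewrite mulr_gt0.
set v := Num.sqrt (T%:R * L).
have v2 : v ^+ 2 = T%:R * L by rewrite sqr_sqrtr ?ltW.
have v0 : 0 <= v by exact: sqrtr_ge0.
set sg := Num.sqrt (sigma2 f xs).
have sg0 : 0 <= sg by exact: sqrtr_ge0.
have sg2 : sg ^+ 2 = sigma2 f xs.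
  by rewrite sqr_sqrtr // sigma2_ge0.
set D := enorm (x0 - xs) ^+ 2.
have D0 : 0 <= D by rewrite exprn_ge0 ?enorm_ge0.
have q3 : eps `^ (3 / 2) = q ^+ 3.
  have -> : 3 / 2 = 1 + 2^-1 :> R by field.
  rewrite powRD; last by apply/implyP => _; rewrite gt_eqF.
  by rewrite powRr1 ?(ltW eps0) // powR12_sqrt ?(ltW eps0) // -/q -q2 -exprSr.
rewrite /complexity -/D -/v -/sg q3 -q2 in hK.
have e2 := @expR1_ge2 R.
set E := expR 1 in hK e2.
have E0 : 0 < E by exact: expR_gt0.
(* [S1] is the inverse of the largest admissible step and [S2] is tuned to the noise. Inverting
   their sum replaces a minimum of two steps and also covers zero noise. *)
pose S1 := 2 * r * (T%:R * L).
pose S2 := 2 * E * r * sg * v / q.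
have S10 : 0 < S1 by rewrite !mulr_gt0.
have S20 : 0 <= S2 by rewrite !mulr_ge0 ?invr_ge0 // ltW.
have S0 : 0 < S1 + S2 by rewrite ltr_wpDr.
pose eta := (S1 + S2)^-1.
have eta0 : 0 < eta by rewrite invr_gt0.
have sq4 : Num.sqrt (4 * l) = 2 * r.
  have -> : 4 * l = (2 * r) ^+ 2 by rewrite exprMn r2; ring.
  by rewrite sqrtr_sqr ger0_norm // mulr_ge0 // ltW.
have eta_le : eta <= (Num.sqrt (4 * l) * T%:R * L)^-1.
  by rewrite sq4 -mulrA lef_pV2 ?posrE // lerDl.
exists eta; split=> //.
have ab : 4^-1 + (4 * l)^-1 <= 1 / 2 :> R.
  have : (4 * l)^-1 <= 4^-1 by rewrite lef_pV2 ?posrE ?mulr_gt0 // ler_peMr.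
  by lra.
have four0 : 0 < 4 :> R by [].
have := @expected_gap_le R s d T L f xs x0 4 (4 * l) eta K T0 L0 cf sf xs_min
  four0 (mulr_gt0 four0 l0) ab eta0 eta_le K0.
have -> : 4 / (4 * l) = l^-1 by field; rewrite gt_eqF.
have -> : 4 * l / 4 = l by field.
have [] := powR_inv_ln_le K%:R KR0 l1; rewrite -/l -/E.
set P1 := powR _ _; set P2 := powR _ _ => hP1 hP2 /le_trans; apply.
have P20 : 0 < P2 by exact: powR_gt0.
rewrite -/D -sg2.
have h1 : eta ^+ 2 * sg ^+ 2 * T%:R * L * (1 + l) * P1 <= eps / 2.
  have hS : eta * S2 <= 1.
    by rewrite /eta mulrC ler_pdivrMr // mul1r lerDr ltW.
  have hS2 : (eta * S2) ^+ 2 <= 1.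
    by rewrite expr_le1 // mulr_ge0 // ltW.
  pose A := eta ^+ 2 * sg ^+ 2 * (T%:R * L).
  have A0 : 0 <= A by rewrite !mulr_ge0 ?exprn_ge0 // ltW.
  have hA : 4 * E ^+ 2 * l * A <= eps.
    have : (eta * S2) ^+ 2 = 4 * E ^+ 2 * l * A / eps.
      by rewrite /A -v2 -r2 -q2 /S2; field; rewrite gt_eqF.
    by move=> hh; rewrite hh ler_pdivrMr // mul1r in hS2.
  have -> : eta ^+ 2 * sg ^+ 2 * T%:R * L * (1 + l) * P1 = A * (1 + l) * P1.
    by rewrite /A; ring.
  have h2 : A * (1 + l) * P1 <= A * (2 * l) * E.
    apply: ler_pM => //.
    - by rewrite mulr_ge0 // addr_ge0 // ltW.
    - exact: powR_ge0.
    - by rewrite ler_wpM2l //; lra.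
  have h3 : A * (2 * l) * E <= A * (2 * l) * E ^+ 2.
    rewrite ler_wpM2l //; first by rewrite !mulr_ge0 // ltW.
    by rewrite expr2 ler_peMl //; lra.
  by lra.
have h2 : D / (2 * T%:R * eta * P2) <= eps / 2.
  have hX : E * D * (S1 + S2) <= q ^+ 2 * (T%:R * K%:R).
    apply: le_trans (ler_wpM2l (ltW (exprn_gt0 2 q0)) hK).
    have -> : q ^+ 2 * (2 * E ^+ 2 * r * (T%:R * L * D / q ^+ 2
        + v * sg * D / q ^+ 3)) =
        E * D * (E * S1 + S2).
      by rewrite /S1 /S2; field; rewrite gt_eqF.
    rewrite ler_wpM2l //; first by rewrite mulr_ge0 // ltW.
    by rewrite lerD2r ler_peMl //; lra.
  have -> : D / (2 * T%:R * eta * P2) = D * (S1 + S2) / (2 * T%:R * P2).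
    by rewrite /eta; field; rewrite !gt_eqF.
  rewrite ler_pdivrMr ?mulr_gt0 //.
  have -> : eps / 2 * (2 * T%:R * P2) = eps * T%:R * P2 by field.
  (* The extra factor [E] pays for replacing [K] by the power [P2]. *)
  have hE : E * (D * (S1 + S2)) <= E * (eps * T%:R * P2).
    apply: (@le_trans _ _ (eps * T%:R * K%:R)); first by rewrite -q2; move: hX; lra.
    by rewrite [E * _]mulrCA ler_wpM2l // mulr_ge0 // ltW.
  by rewrite ler_pM2l in hE.
by lra.
Qed.

Theorem corollary2p5 (R : realType) :
  exists C p : R, 0 < C /\ 0 < p /\
  forall (s : shuffling) (d T : nat) (L : R) (f : 'I_T -> 'rV[R]_d -> R)
    (xs x0 : 'rV[R]_d),
    (1 <= T)%N -> 0 < L ->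
    (forall t, convex_function setT (f t)) ->
    (forall t, smooth L (f t)) ->
    is_minimizer (avg f) xs ->
    (forall (alpha beta eta : R) (K : nat),
       0 < alpha -> 0 < beta -> alpha^-1 + beta^-1 <= 1 / 2 ->
       0 < eta -> eta <= (Num.sqrt beta * T%:R * L)^-1 ->
       (1 <= K)%N ->
       expected_gap s f xs x0 eta K <=
         expR 1 * eta ^+ 2 * sigma2 f xs * T%:R * L * (1 + beta / alpha)
           * K%:R `^ ((alpha / beta) / (1 + alpha / beta))
         + expR 1 * enorm (x0 - xs) ^+ 2
           / (2 * T%:R * eta * K%:R `^ (1 / (1 + alpha / beta)))) /\
    (forall eps : R, 0 < eps ->
       let X := complexity L f xs x0 eps in
       T%:R <= X ->
       exists (K : nat) (eta : R),
         1 <= ln (K%:R : R) /\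
         0 < eta /\ eta <= (Num.sqrt (4 * ln (K%:R : R)) * T%:R * L)^-1 /\
         expected_gap s f xs x0 eta K <= eps /\
         (T * K)%N%:R <= C * X * (ln (expR 1 + X)) `^ p).
Proof.
(* Both constants come from [epoch_count_exists]: its bound has a single logarithm. *)
exists (expR 7), 1; split; first exact: expR_gt0.
split=> // s d T L f xs x0 T0 L0 cf sf xs_min; split.
  move=> alpha beta eta K a0 b0 ab e0 eta_le K0.
  apply: (le_trans (expected_gap_le s d T L f xs x0 alpha beta eta K
    T0 L0 cf sf xs_min a0 b0 ab e0 eta_le K0)).
  have e1 : 1 <= expR 1 :> R by have := expR1_ge2 (R := R); lra.
  have s0 := sigma2_ge0 f xs.
  apply: lerD.
    have ba : 0 <= 1 + beta / alpha by rewrite addr_ge0 // divr_ge0 // ltW.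
    move: (sigma2 f xs) s0 => sg s0; rewrite -!(mulrA (expR 1)) ler_peMl //.
    by rewrite !mulr_ge0 ?powR_ge0 ?exprn_ge0 ?(ltW e0) ?(ltW L0).
  rewrite -(mulrA (expR 1)) ler_peMl // divr_ge0 ?exprn_ge0 ?enorm_ge0 //.
  by rewrite !mulr_ge0 ?powR_ge0 // ltW.
move=> eps eps0 X TX.
have [K [l1 hK TK]] := epoch_count_exists T X T0 TX.
have [eta [eta0 eta_le gap_le]] :=
  constant_step_gap_le R s d T L f xs x0 eps K T0 L0 cf sf xs_min eps0 l1 hK.
exists K, eta; do 4!split=> //.
rewrite natrM powRr1 //.
have X0 : 0 <= X by apply: le_trans TX.
by rewrite ln_ge0 // ler_wpDr // ltW // expR_gt1.
Qed.
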